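(* The assignment $\mathcal{E}$ is a Lax functor from the category $\mathrm{Top}$ of topological spaces and continuous maps to the strict $2$-category $\mathrm{Corr}_{\mathrm{Gr}}$ of correspondences of groups. Namely: (1) to a topological space $X$ is assigned the group $\mathcal{E}(X)$; (2) to a continuous map $f:X\to Y$ is assigned the correspondence of groups $\mathcal{E}(X)\xleftarrow{p_1}\mathcal{E}(f)\xrightarrow{p_2}\mathcal{E}(Y)$; (3) for continuous maps $f:X\to Y$ and $g:Y\to Z$ there is a $2$-morphism $\mathcal{E}(g)\copyright\mathcal{E}(f)\Longrightarrow\mathcal{E}(g\circ f)$, i.e. $\mathcal{E}(g)\copyright\mathcal{E}(f)\subset\mathcal{E}(g\circ f)$.
   Context: Homotopies are free (no base points). $\mathcal{E}(X)$ is the group, under composition, of homotopy classes $[h]$ of homotopy self-equivalences $h:X\to X$, i.e. the unit group of the monoid $[X,X]$. For a continuous map $f:X\to Y$, $$\mathcal{E}(f):=\{([h_X],[h_Y])\in\mathcal{E}(X)\times\mathcal{E}(Y)\mid f\circ h_X\simeq h_Y\circ f\},$$ a subgroup of $\mathcal{E}(X)\times\mathcal{E}(Y)$; $p_1,p_2$ are the restrictions of the two projections. $\mathrm{Corr}_{\mathrm{Gr}}$ is the strict $2$-category whose objects are groups, whose $1$-morphisms from $G$ to $F$ are correspondences, i.e. subgroups $S\subset G\times F$ (with the two restricted projections), and in which there is a unique $2$-morphism $S_1\Rightarrow S_2$ if $S_1\subset S_2$ and none otherwise. Composition of $S\subset G\times F$ and $S'\subset F\times K$ is $S'\copyright S:=\{(g,k)\in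 G\times K\mid \exists f\in F,\ (g,f)\in S,\ (f,k)\in S'\}$, and the identity $1$-morphism of $G$ is the diagonal $\Delta(G)$. A Lax functor is meant in the usual sense, with $\mathrm{Top}$ regarded as a $2$-category with only identity $2$-morphisms; since the hom-categories of $\mathrm{Corr}_{\mathrm{Gr}}$ are posets, all coherence conditions are automatic. *)

(* Defs.v *)
From HB Require Import structures.
From mathcomp Require Import all_boot all_order all_algebra.
From mathcomp Require Import all_classical all_reals all_analysis.

Set Implicit Arguments.
Unset Strict Implicit.
Unset Printing Implicit Defensive.

Import Order.TTheory GRing.Theory Num.Theory.
Import numFieldNormedType.Exports.

Local Open Scope classical_set_scope.
Local Open Scope quotient_scope.

(** * Strict 2-categories and lax functors *)

(* The 2-cell between equal 1-cells, for [A] the 2-cells and [id] their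
   identities. *)
Definition cell_of_eq (T : Type) (A : T -> T -> Type) (id : forall x, A x x)
    (x y : T) (e : x = y) : A x y :=
  let: erefl := e in id x.

(* The 1-cells [h (g f)] and [(h g) f] are equal but not convertible, hence
   the strict laws of horizontal composition are stated up to [cell_of_eq]. *)
Record strict_2category := Strict2Category {
  ob :> Type;
  hom : ob -> ob -> Type;
  cell : forall x y : ob, hom x y -> hom x y -> Type;
  id1 : forall x : ob, hom x x;
  comp1 : forall x y z : ob, hom y z -> hom x y -> hom x z;
  id2 : forall (x y : ob) (f : hom x y), cell f f;
  vcomp : forall (x y : ob) (f g h : hom x y),
    cell g h -> cell f g -> cell f h;
  hcomp : forall (x y z : ob) (f f' : hom x y) (g g' : hom y z),
    cell g g' -> cell f f' -> cell (comp1 g f) (comp1 g' f');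
  comp1A : forall (x y z w : ob) (f : hom x y) (g : hom y z) (h : hom z w),
    comp1 h (comp1 g f) = comp1 (comp1 h g) f;
  comp1_id1l : forall (x y : ob) (f : hom x y), comp1 (id1 y) f = f;
  comp1_id1r : forall (x y : ob) (f : hom x y), comp1 f (id1 x) = f;
  vcompA : forall (x y : ob) (f g h k : hom x y)
      (a : cell f g) (b : cell g h) (c : cell h k),
    vcomp c (vcomp b a) = vcomp (vcomp c b) a;
  vcomp_id2l : forall (x y : ob) (f g : hom x y) (a : cell f g),
    vcomp (id2 g) a = a;
  vcomp_id2r : forall (x y : ob) (f g : hom x y) (a : cell f g),
    vcomp a (id2 f) = a;
  hcomp_id2 : forall (x y z : ob) (f : hom x y) (g : hom y z),
    hcomp (id2 g) (id2 f) = id2 (comp1 g f);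
  interchange : forall (x y z : ob) (f f' f'' : hom x y) (g g' g'' : hom y z)
      (a : cell f f') (a' : cell f' f'') (b : cell g g') (b' : cell g' g''),
    hcomp (vcomp b' b) (vcomp a' a) = vcomp (hcomp b' a') (hcomp b a);
  hcompA : forall (x y z w : ob) (f f' : hom x y) (g g' : hom y z)
      (h h' : hom z w) (a : cell f f') (b : cell g g') (c : cell h h'),
    vcomp (cell_of_eq (@id2 x w) (comp1A f' g' h')) (hcomp c (hcomp b a)) =
    vcomp (hcomp (hcomp c b) a) (cell_of_eq (@id2 x w) (comp1A f g h));
  hcomp_id1l : forall (x y : ob) (f f' : hom x y) (a : cell f f'),
    vcomp (cell_of_eq (@id2 x y) (comp1_id1l f')) (hcomp (id2 (id1 y)) a) =
    vcomp a (cell_of_eq (@id2 x y) (comp1_id1l f));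
  hcomp_id1r : forall (x y : ob) (f f' : hom x y) (a : cell f f'),
    vcomp (cell_of_eq (@id2 x y) (comp1_id1r f')) (hcomp a (id2 (id1 x))) =
    vcomp a (cell_of_eq (@id2 x y) (comp1_id1r f))
}.

Arguments hom {s}.
Arguments cell {s x y}.
Arguments id1 {s}.
Arguments comp1 {s x y z}.
Arguments id2 {s x y}.
Arguments vcomp {s x y f g h}.
Arguments hcomp {s x y z f f' g g'}.
Arguments comp1A {s x y z w}.
Arguments comp1_id1l {s x y}.
Arguments comp1_id1r {s x y}.

Definition eq2 (C : strict_2category) (x y : C) (f g : hom x y) (e : f = g) :
  cell f g := cell_of_eq (@id2 C x y) e.

(* The action on objects and 1-cells, with no law required. *)
Record assignment (C D : strict_2category) := Assignment {
  on_ob :> C -> D;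
  on_hom : forall x y : C, hom x y -> hom (on_ob x) (on_ob y)
}.

Arguments on_hom {C D} a {x y}.

Record lax_functor (C D : strict_2category) := LaxFunctor {
  lax_assignment :> assignment C D;
  on_cell : forall (x y : C) (f g : hom x y),
    cell f g -> cell (on_hom lax_assignment f) (on_hom lax_assignment g);
  lax_id : forall x : C,
    cell (id1 (lax_assignment x)) (on_hom lax_assignment (id1 x));
  lax_comp : forall (x y z : C) (f : hom x y) (g : hom y z),
    cell (comp1 (on_hom lax_assignment g) (on_hom lax_assignment f))
         (on_hom lax_assignment (comp1 g f));
  on_cell_id2 : forall (x y : C) (f : hom x y),
    on_cell (id2 f) = id2 (on_hom lax_assignment f);
  on_cell_vcomp : forall (x y : C) (f g h : hom x y)
      (a : cell f g) (b : cell g h),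
    on_cell (vcomp b a) = vcomp (on_cell b) (on_cell a);
  lax_comp_natural : forall (x y z : C) (f f' : hom x y) (g g' : hom y z)
      (a : cell f f') (b : cell g g'),
    vcomp (on_cell (hcomp b a)) (lax_comp f g) =
    vcomp (lax_comp f' g') (hcomp (on_cell b) (on_cell a));
  lax_compA : forall (x y z w : C)
      (f : hom x y) (g : hom y z) (h : hom z w),
    vcomp (on_cell (eq2 (comp1A f g h)))
      (vcomp (lax_comp (comp1 g f) h)
        (hcomp (id2 (on_hom lax_assignment h)) (lax_comp f g))) =
    vcomp (lax_comp f (comp1 h g))
      (vcomp (hcomp (lax_comp g h) (id2 (on_hom lax_assignment f)))
        (eq2 (comp1A (on_hom lax_assignment f) (on_hom lax_assignment g)
                     (on_hom lax_assignment h))));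
  lax_comp_idl : forall (x y : C) (f : hom x y),
    vcomp (on_cell (eq2 (comp1_id1l f)))
      (vcomp (lax_comp f (id1 y))
        (hcomp (lax_id y) (id2 (on_hom lax_assignment f)))) =
    eq2 (comp1_id1l (on_hom lax_assignment f));
  lax_comp_idr : forall (x y : C) (f : hom x y),
    vcomp (on_cell (eq2 (comp1_id1r f)))
      (vcomp (lax_comp (id1 x) f)
        (hcomp (id2 (on_hom lax_assignment f)) (lax_id x))) =
    eq2 (comp1_id1r (on_hom lax_assignment f))
}.

(* The strict 2-category with at most one 2-cell between parallel 1-cells. *)
Definition locally_posetal (ob : Type) (hom : ob -> ob -> Type)
    (le : forall x y, hom x y -> hom x y -> Prop)
    (id1 : forall x, hom x x)
    (comp1 : forall x y z, hom y z -> hom x y -> hom x z)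
    (le_refl : forall x y (f : hom x y), le x y f f)
    (le_trans : forall x y (f g h : hom x y),
      le x y f g -> le x y g h -> le x y f h)
    (le_comp : forall x y z (f f' : hom x y) (g g' : hom y z),
      le y z g g' -> le x y f f' ->
      le x z (comp1 x y z g f) (comp1 x y z g' f'))
    (comp1A : forall x y z w (f : hom x y) (g : hom y z) (h : hom z w),
      comp1 x z w h (comp1 x y z g f) = comp1 x y w (comp1 y z w h g) f)
    (comp1_id1l : forall x y (f : hom x y), comp1 x y y (id1 y) f = f)
    (comp1_id1r : forall x y (f : hom x y), comp1 x x y f (id1 x) = f) :
  strict_2category.
Proof.
refine (@Strict2Category ob hom le id1 comp1 le_refl
  (fun x y f g h b a => le_trans x y f g h a b) le_comp
  comp1A comp1_id1l comp1_id1r _ _ _ _ _ _ _ _);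
by move=> *; exact: Prop_irrelevance.
Defined.

(** * Topological spaces, with only identity 2-cells *)

Definition ccomp (X Y Z : topologicalType) (g : continuousType Y Z)
  (f : continuousType X Y) : continuousType X Z := g \o f.

Definition cid_map (X : topologicalType) : continuousType X X := idfun.

Lemma ccompA (X Y Z W : topologicalType) (f : continuousType X Y)
    (g : continuousType Y Z) (h : continuousType Z W) :
  ccomp h (ccomp g f) = ccomp (ccomp h g) f.
Proof. exact/continuousEP. Qed.

Lemma ccomp_idl (X Y : topologicalType) (f : continuousType X Y) :
  ccomp (cid_map Y) f = f.
Proof. exact/continuousEP. Qed.

Lemma ccomp_idr (X Y : topologicalType) (f : continuousType X Y) :
  ccomp f (cid_map X) = f.
Proof. exact/continuousEP. Qed.

Definition Top : strict_2category :=
  @locally_posetal topologicalType (fun X Y => continuousType X Y)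
    (fun X Y f g => f = g) cid_map ccomp (fun X Y => @erefl _)
    (fun X Y => @etrans _)
    (fun X Y Z f f' g g' => @f_equal2 _ _ _ (@ccomp X Y Z) g g' f f')
    ccompA ccomp_idl ccomp_idr.

(** * Correspondences of groups *)

(* A 1-cell from [G] to [F] is a subgroup of [G * F]; the two legs of the span
   are the restricted projections, so they are not recorded. *)

Section Correspondence.
Implicit Types G F K L : groupType.

Record correspondence G F := Correspondence {
  corr_set :> set (G * F);
  corr_closed : group_closed (mem corr_set)
}.

Lemma corr_eq G F (S T : correspondence G F) :
  corr_set S = corr_set T -> S = T.
Proof.
case: S T => S hS [T hT] /= eST; subst T.
by congr Correspondence; exact: Prop_irrelevance.
Qed.

Local Open Scope group_scope.

Lemma group_closed_setP G (S : set G) :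
  S 1 -> (forall x y, S x -> S y -> S (x / y)) -> group_closed (mem S).
Proof.
move=> S1 SV; split; first exact/mem_set.
by move=> x y /set_mem Sx /set_mem Sy; exact/mem_set/SV.
Qed.

Lemma corr1 G F (S : correspondence G F) : corr_set S (1, 1).
Proof. by case: (corr_closed S) => /set_mem. Qed.

Lemma corrF G F (S : correspondence G F) x y :
  corr_set S x -> corr_set S y -> corr_set S (x / y).
Proof.
by case: (corr_closed S) => _ SV Sx Sy; apply/set_mem/SV; exact/mem_set.
Qed.

Definition corr_comp_set G F K (S' : set (F * K)) (S : set (G * F)) :
    set (G * K) :=
  [set p | exists f, S (p.1, f) /\ S' (f, p.2)].

Lemma corr_comp_closed G F K (S' : correspondence F K)
  (S : correspondence G F) : group_closed (mem (corr_comp_set S' S)).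
Proof.
apply: group_closed_setP; first by exists 1; split; exact: corr1.
move=> [g k] [g' k'] [f [Sf Sf']] [f' [Tf Tf']]; exists (f / f').
by split; [exact: (corrF Sf Tf)|exact: (corrF Sf' Tf')].
Qed.

Definition corr_comp G F K (S' : correspondence F K)
    (S : correspondence G F) : correspondence G K :=
  Correspondence (@corr_comp_closed G F K S' S).

Lemma corr_diag_closed G : group_closed (mem [set p : G * G | p.1 = p.2]).
Proof.
by apply: group_closed_setP => // p q /= p12 q12; rewrite p12 q12.
Qed.

Definition corr_diag G : correspondence G G :=
  Correspondence (@corr_diag_closed G).

Lemma corr_compA G F K L (S : correspondence G F) (S' : correspondence F K)
    (S'' : correspondence K L) :
  corr_comp S'' (corr_comp S' S) = corr_comp (corr_comp S'' S') S.
Proof.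
apply/corr_eq/seteqP; split=> -[g l] /=.
- by move=> [k [[f [Sf Sf']] Sk]]; exists f; split=> //; exists k.
- by move=> [f [Sf [k [Sf' Sk]]]]; exists k; split=> //; exists f.
Qed.

Lemma corr_comp_diagl G F (S : correspondence G F) :
  corr_comp (corr_diag F) S = S.
Proof.
apply/corr_eq/seteqP; split=> -[g f] /=; first by move=> [f' [Sf /= <-]].
by move=> Sf; exists f.
Qed.

Lemma corr_comp_diagr G F (S : correspondence G F) :
  corr_comp S (corr_diag G) = S.
Proof.
apply/corr_eq/seteqP; split=> -[g f] /=; first by move=> [g' [/= -> Sf]].
by move=> Sf; exists g.
Qed.

End Correspondence.

Lemma corr_compS (G F K : groupType) (S T : correspondence G F)
    (S' T' : correspondence F K) :
  S' `<=` T' -> S `<=` T -> corr_comp S' S `<=` corr_comp T' T.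
Proof. by move=> S'T' ST [g k] [f [Sf Sf']]; exists f; split; auto. Qed.

Definition Corr_Gr : strict_2category :=
  @locally_posetal groupType correspondence (fun G F S1 S2 => S1 `<=` S2)
    corr_diag corr_comp (fun G F S => @subset_refl _ S)
    (fun G F S1 S2 S3 => @subset_trans _ S2 S1 S3)
    corr_compS corr_compA corr_comp_diagl corr_comp_diagr.

(** * Free homotopy *)

Definition unit_interval (R : realType) : topologicalType :=
  set_type (`[0%R, 1%R]%classic : set R).

Definition homotopic (R : realType) (X Y : topologicalType)
    (f g : continuousType X Y) : Prop :=
  exists H : continuousType (X * unit_interval R)%type Y,
    forall (x : X) (t : unit_interval R),
      (\val t = 0%R -> H (x, t) = f x) /\ (\val t = 1%R -> H (x, t) = g x).

Section Homotopy.
Variable R : realType.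
Local Open Scope ring_scope.

Lemma continuous_val : continuous (fun t : unit_interval R => \val t : R).
Proof. exact: (@initial_continuous (set_type _) R (\val)). Qed.

Lemma continuous_pair (T U V : topologicalType) (f : T -> U) (g : T -> V) :
  continuous f -> continuous g -> continuous (fun p => (f p, g p)).
Proof. by move=> cf cg p; exact: (cvg_pair (cf p) (cg p)). Qed.

Lemma continuous_fst (U V : topologicalType) : continuous (@fst U V).
Proof. by move=> [x t]; exact: cvg_fst. Qed.

Lemma continuous_snd (U V : topologicalType) : continuous (@snd U V).
Proof. by move=> [x t]; exact: cvg_snd. Qed.

Definition clamp (r : R) : R := Num.min 1 (Num.max 0 r).

Lemma clamp_in (r : R) : clamp r \in (`[0, 1]%classic : set R).
Proof.
rewrite inE /= in_itv /= /clamp ge_min lexx /= andbT le_min ler01 /=.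
by rewrite le_max lexx.
Qed.

Definition clampI (r : R) : unit_interval R := exist _ (clamp r) (clamp_in r).

Lemma clampE (r : R) : 0 <= r <= 1 -> \val (clampI r) = r.
Proof. by move=> /andP[r0 r1]; rewrite /= /clamp max_r// min_r. Qed.

Lemma continuous_clampI : continuous clampI.
Proof.
apply: continuous_comp_initial => r /=.
apply: (@continuous_min R R (cst 1)); first exact: cst_continuous.
apply: (@continuous_max R R (cst 0)); first exact: cst_continuous.
by move=> U.
Qed.

Lemma homotopic_refl (X Y : topologicalType) (f : continuousType X Y) :
  homotopic R f f.
Proof.
have cH : continuous (fun p : X * unit_interval R => f p.1).
  by move=> p; apply: continuous_comp; [exact: continuous_fst|exact: cts_fun].
by exists (mkcts cH).
Qed.

Lemma continuous_reparam (X Y : topologicalType)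
    (H : continuousType (X * unit_interval R)%type Y) (u : R -> R) :
  continuous u ->
  continuous (fun p : X * unit_interval R => H (p.1, clampI (u (\val p.2)))).
Proof.
move=> cu p; apply: (@continuous_comp _ _ _
  (fun p : X * unit_interval R => (p.1, clampI (u (\val p.2)))) H);
  last exact: cts_fun.
move: p; apply: continuous_pair; first exact: continuous_fst.
move=> p.
apply: (@continuous_comp _ _ _ (fun p : X * unit_interval R => u (\val p.2))
  clampI); last exact: continuous_clampI.
apply: (@continuous_comp _ _ _ (fun p : X * unit_interval R => \val p.2 : R) u);
  last exact: cu.
apply: (@continuous_comp _ _ _ snd (fun t : unit_interval R => \val t : R)).
  exact: continuous_snd.
exact: continuous_val.
Qed.

Lemma homotopic_sym (X Y : topologicalType) (f g : continuousType X Y) :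
  homotopic R f g -> homotopic R g f.
Proof.
move=> [H HE]; have cu : continuous (fun r : R => 1 - r).
  by move=> r; apply: cvgB; [exact: cvg_cst|exact: cvg_id].
exists (mkcts (continuous_reparam (H := H) cu)) => x t.
rewrite /mkcts /=; split=> t01.
  by apply: (HE x _).2; rewrite clampE t01 subr0// ler01 lexx.
by apply: (HE x _).1; rewrite clampE t01 subrr// ler01 lexx.
Qed.

Lemma homotopic_trans (X Y : topologicalType) (f g h : continuousType X Y) :
  homotopic R f g -> homotopic R g h -> homotopic R f h.
Proof.
move=> [H HE] [K KE].
have cu : continuous (fun r : R => 2 * r).
  by move=> r; apply: cvgM; [exact: cvg_cst|exact: cvg_id].
have cv : continuous (fun r : R => 2 * r - 1).
  by move=> r; apply: cvgB; [exact: cu|exact: cvg_cst].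
have cH := continuous_reparam (H := H) cu.
have cK := continuous_reparam (H := K) cv.
pose L (p : X * unit_interval R) :=
  if \val p.2 <= 2^-1 :> R then H (p.1, clampI (2 * \val p.2))
  else K (p.1, clampI (2 * \val p.2 - 1)).
have ct : continuous (fun p : X * unit_interval R => \val p.2 : R).
  move=> p; apply: (@continuous_comp _ _ _ snd
    (fun t : unit_interval R => \val t : R)); first exact: continuous_snd.
  exact: continuous_val.
pose A := [set p : X * unit_interval R | \val p.2 <= 2^-1 :> R].
pose B := [set p : X * unit_interval R | 2^-1 <= \val p.2 :> R].
have cA : closed A.
  by apply: (@preimage_closed _ _ _ [set r : R | r <= 2^-1]);
    [move=> p _; exact: ct|exact: closed_le].
have cB : closed B.
  by apply: (@preimage_closed _ _ _ [set r : R | 2^-1 <= r]);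
    [move=> p _; exact: ct|exact: closed_ge].
have AB : A `|` B = setT.
  by rewrite -subTset => p _; case: (leP (\val p.2 : R) 2^-1) => pA;
    [left|right; exact: ltW].
have cL : continuous L.
  apply/continuous_subspace_setT; rewrite -AB; apply: withinU_continuous => //.
    apply: subspace_eq_continuous (continuous_subspaceT cH) => p.
    by rewrite inE /from_subspace /A /L /= => ->.
  apply: subspace_eq_continuous (continuous_subspaceT cK) => p.
  rewrite inE /from_subspace /B /L /= => pB; case: ifPn => // pA.
  have /eqP p2 : \val p.2 == 2^-1 :> R by rewrite eq_le pA pB.
  rewrite p2 divff ?pnatr_eq0// subrr (KE _ _).1; last first.
    by rewrite clampE ?ler01 ?lexx.
  by rewrite (HE _ _).2// clampE ?ler01 ?lexx.
exists (mkcts cL) => x t; rewrite /= /mkcts /L /=; split=> t01; rewrite t01.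
  rewrite invr_ge0 ler0n; apply: (HE _ _).1.
  by rewrite mulr0 clampE ?ler01 ?lexx.
have /negbTE -> : ~~ (1 <= 2^-1 :> R) by rewrite -ltNge invf_lt1 ?ltr0n ?ltr1n.
apply: (KE _ _).2.
have -> : 2 * 1 - 1 = 1 :> R by rewrite mulr1 -[in 2]natr1 addrK.
by rewrite clampE ?ler01 ?lexx.
Qed.

Lemma homotopic_comp (X Y Z : topologicalType) (f f' : continuousType X Y)
    (g g' : continuousType Y Z) :
  homotopic R g g' -> homotopic R f f' ->
  homotopic R (ccomp g f) (ccomp g' f').
Proof.
move=> [K KE] [H HE].
have cL : continuous (fun p : X * unit_interval R => K (H p, p.2)).
  move=> p; apply: (@continuous_comp _ _ _
    (fun p : X * unit_interval R => (H p, p.2)) K); last exact: cts_fun.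
  by move: p; apply: continuous_pair; [exact: cts_fun|exact: continuous_snd].
exists (mkcts cL) => x t; rewrite /= /mkcts /=.
by split=> t01; [rewrite (HE x t).1// (KE _ t).1|rewrite (HE x t).2// (KE _ t).2].
Qed.

Lemma homotopic_of_eq (X Y : topologicalType) (f g : continuousType X Y) :
  f = g -> homotopic R f g.
Proof. by move=> ->; exact: homotopic_refl. Qed.

End Homotopy.

(** * The group of homotopy self-equivalences and the correspondence of a map *)

(* [selfE R X] is E(X) and [map_corr R f] is E(f); the law of E(X) is
   [h][k] = [h o k], see [selfE_mul_class]. *)
Section SelfEquivalences.
Variable R : realType.
Implicit Types X Y : topologicalType.

Definition homotopy_equivalence X Y (h : continuousType X Y) : Prop :=
  exists k : continuousType Y X,
    homotopic R (ccomp k h) (cid_map X) /\ homotopic R (ccomp h k) (cid_map Y).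

Definition self_equiv X : Type :=
  {h : continuousType X X | `[< homotopy_equivalence h >]}.

Definition self_homotopic X (h k : self_equiv X) : bool :=
  `[< homotopic R (\val h) (\val k) >].

Lemma self_homotopic_refl X : reflexive (@self_homotopic X).
Proof. by move=> h; apply/asboolP; exact: homotopic_refl. Qed.

Lemma self_homotopic_sym X : symmetric (@self_homotopic X).
Proof. by move=> h k; apply/asboolP/asboolP; exact: homotopic_sym. Qed.

Lemma self_homotopic_trans X : transitive (@self_homotopic X).
Proof.
by move=> k h l /asboolP hk /asboolP kl; apply/asboolP/(homotopic_trans hk kl).
Qed.

Canonical self_homotopic_equiv X := EquivRel (@self_homotopic X)
  (@self_homotopic_refl X) (@self_homotopic_sym X) (@self_homotopic_trans X).

Definition selfE X : Type := {eq_quot (@self_homotopic X)}.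

HB.instance Definition _ X := Choice.on (selfE X).

Definition hclass X (h : self_equiv X) : selfE X := \pi_(selfE X) h.

Lemma hclass_eqP X (h k : self_equiv X) :
  hclass h = hclass k <-> homotopic R (\val h) (\val k).
Proof.
split=> [/eqquotP/asboolP //|hk]; apply/eqquotP; exact/asboolP.
Qed.

Lemma hclass_repr X (a : selfE X) : hclass (repr a) = a.
Proof. exact: reprK. Qed.

Lemma self_equivP X (h : self_equiv X) : homotopy_equivalence (\val h).
Proof. exact/asboolP/(valP h). Qed.

Lemma homotopy_equivalence_id X : homotopy_equivalence (cid_map X).
Proof. by exists (cid_map X); split; exact/homotopic_of_eq/ccomp_idl. Qed.

Lemma homotopy_equivalence_comp X (h k : continuousType X X) :
  homotopy_equivalence h -> homotopy_equivalence k ->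
  homotopy_equivalence (ccomp h k).
Proof.
move=> [h' [h'h hh']] [k' [k'k kk']]; exists (ccomp k' h'); split.
- apply: homotopic_trans k'k; rewrite -ccompA.
  apply: homotopic_comp; first exact: homotopic_refl.
  rewrite ccompA -[X in homotopic _ _ X]ccomp_idl.
  by apply: homotopic_comp h'h _; exact: homotopic_refl.
- apply: homotopic_trans hh'; rewrite -ccompA.
  apply: homotopic_comp; first exact: homotopic_refl.
  rewrite ccompA -[X in homotopic _ _ X]ccomp_idl.
  by apply: homotopic_comp kk' _; exact: homotopic_refl.
Qed.

Definition self_id X : self_equiv X :=
  exist _ (cid_map X) (asboolT (@homotopy_equivalence_id X)).

Definition self_comp X (h k : self_equiv X) : self_equiv X :=
  exist _ (ccomp (\val h) (\val k))
    (asboolT (homotopy_equivalence_comp (self_equivP h) (self_equivP k))).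

Lemma self_inv_ex X (h : self_equiv X) : exists k : self_equiv X,
  homotopic R (ccomp (\val k) (\val h)) (cid_map X) /\
  homotopic R (ccomp (\val h) (\val k)) (cid_map X).
Proof.
have [k [kh hk]] := self_equivP h.
have kP : homotopy_equivalence k by exists (\val h).
by exists (exist _ k (asboolT kP)).
Qed.

Definition self_inv X (h : self_equiv X) : self_equiv X :=
  projT1 (cid (self_inv_ex h)).

Lemma self_invP X (h : self_equiv X) :
  homotopic R (ccomp (\val (self_inv h)) (\val h)) (cid_map X) /\
  homotopic R (ccomp (\val h) (\val (self_inv h))) (cid_map X).
Proof. exact: (projT2 (cid (self_inv_ex h))). Qed.

Definition selfE_one X : selfE X := hclass (self_id X).
Definition selfE_mul X (a b : selfE X) : selfE X :=
  hclass (self_comp (repr a) (repr b)).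
Definition selfE_inv X (a : selfE X) : selfE X := hclass (self_inv (repr a)).

Lemma selfE_mul_class X (h k : self_equiv X) :
  selfE_mul (hclass h) (hclass k) = hclass (self_comp h k).
Proof.
apply/hclass_eqP; apply: homotopic_comp; apply/hclass_eqP; exact: hclass_repr.
Qed.

Lemma selfE_mulA X : associative (@selfE_mul X).
Proof.
move=> a b c; rewrite -(hclass_repr a) -(hclass_repr b) -(hclass_repr c).
rewrite !selfE_mul_class; apply/hclass_eqP/homotopic_of_eq; exact: ccompA.
Qed.

Lemma selfE_mul1 X : left_id (@selfE_one X) (@selfE_mul X).
Proof.
move=> a; rewrite -(hclass_repr a) selfE_mul_class.
apply/hclass_eqP/homotopic_of_eq; exact: ccomp_idl.
Qed.

Lemma selfE_1mul X : right_id (@selfE_one X) (@selfE_mul X).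
Proof.
move=> a; rewrite -(hclass_repr a) selfE_mul_class.
apply/hclass_eqP/homotopic_of_eq; exact: ccomp_idr.
Qed.

Lemma selfE_mulV X : left_inverse (@selfE_one X) (@selfE_inv X) (@selfE_mul X).
Proof.
move=> a; rewrite -{2}(hclass_repr a) selfE_mul_class.
by apply/hclass_eqP; exact: (self_invP _).1.
Qed.

Lemma selfE_Vmul X : right_inverse (@selfE_one X) (@selfE_inv X) (@selfE_mul X).
Proof.
move=> a; rewrite -{1}(hclass_repr a) selfE_mul_class.
by apply/hclass_eqP; exact: (self_invP _).2.
Qed.

HB.instance Definition _ X := isGroup.Build (selfE X)
  (@selfE_mulA X) (@selfE_mul1 X) (@selfE_1mul X) (@selfE_mulV X)
  (@selfE_Vmul X).

Definition map_corr_set X Y (f : continuousType X Y) :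
    set (selfE X * selfE Y) :=
  [set p | exists (hX : self_equiv X) (hY : self_equiv Y),
    p = (hclass hX, hclass hY) /\
    homotopic R (ccomp f (\val hX)) (ccomp (\val hY) f)].

Lemma map_corr_closed X Y (f : continuousType X Y) :
  group_closed (mem (map_corr_set f)).
Proof.
apply: group_closed_setP.
  exists (self_id X), (self_id Y); split=> //.
  by apply: homotopic_of_eq; rewrite /= ccomp_idl ccomp_idr.
move=> _ _ [h [h' [-> hf]]] [k [k' [-> kf]]].
have VE Z (l : self_equiv Z) : (hclass l)^-1%g = hclass (self_inv l).
  apply: (mulgI (hclass l)); rewrite mulgV; symmetry.
  rewrite [LHS]selfE_mul_class; apply/hclass_eqP; exact: (self_invP l).2.
exists (self_comp h (self_inv k)), (self_comp h' (self_inv k')); split.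
  transitivity
    ((hclass h * (hclass k)^-1)%g, (hclass h' * (hclass k')^-1)%g) => //.
  by rewrite !VE; congr (_, _); exact: selfE_mul_class.
rewrite /= ccompA -[X in homotopic _ _ X]ccompA.
apply: (@homotopic_trans _ _ _ _ (ccomp (ccomp (\val h') f) (\val (self_inv k)))).
  by apply: homotopic_comp hf _; exact: homotopic_refl.
rewrite -ccompA; apply: homotopic_comp; first exact: homotopic_refl.
have [k'V _] := self_invP k'; have [_ kV] := self_invP k.
apply: (@homotopic_trans _ _ _ _ (ccomp (\val (self_inv k'))
  (ccomp (ccomp (\val k') f) (\val (self_inv k))))).
  rewrite -ccompA ccompA -[X in homotopic _ X _]ccomp_idl.
  by apply: homotopic_comp; [exact: homotopic_sym|exact: homotopic_refl].
apply: homotopic_comp; first exact: homotopic_refl.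
apply: (@homotopic_trans _ _ _ _ (ccomp (ccomp f (\val k)) (\val (self_inv k)))).
  apply: homotopic_comp; first exact: homotopic_sym.
  exact: homotopic_refl.
rewrite -ccompA -[X in homotopic _ _ X]ccomp_idr.
by apply: homotopic_comp kV; exact: homotopic_refl.
Qed.

Definition map_corr X Y (f : continuousType X Y) :
    correspondence (selfE X) (selfE Y) :=
  Correspondence (@map_corr_closed X Y f).

Definition selfE_assignment : assignment Top Corr_Gr :=
  @Assignment Top Corr_Gr (fun X => selfE X : groupType) map_corr.

End SelfEquivalences.

(* Main.v *)
Require Import Defs.
From mathcomp Require Import all_boot all_order all_algebra.
From mathcomp Require Import all_classical all_reals all_analysis.

(** The parallel 2-cells of Corr_Gr are proofs of one inclusion, hence equal, so
    all coherence laws of a lax functor into it hold automatically and only the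
    existence of the structure cells matters. The cells of Top are equalities, so
    the action on cells is rewriting. The unit cell says that the diagonal
    of E(X) lies in E(id), because id commutes with every map
    ([corr_diag_sub_map_corr]). The composition cell is the pasting of two
    homotopy-commutative squares along a self-equivalence of the middle space
    ([map_corr_comp_sub]). *)

Local Open Scope classical_set_scope.

(** Every law of a lax functor is an equation between parallel 2-cells of the
    target, so it holds as soon as such cells coincide. *)
Lemma lax_functor_of_thin (C D : strict_2category) (A : assignment C D) :
  (forall (x y : D) (f g : Defs.hom x y) (a b : cell f g), a = b) ->
  (forall (x y : C) (f g : Defs.hom x y),
    cell f g -> cell (on_hom A f) (on_hom A g)) ->
  (forall x : C, cell (id1 (A x)) (on_hom A (id1 x))) ->
  (forall (x y z : C) (f : Defs.hom x y) (g : Defs.hom y z),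
    cell (comp1 (on_hom A g) (on_hom A f)) (on_hom A (comp1 g f))) ->
  exists F : lax_functor C D, lax_assignment F = A.
Proof.
move=> thin Acell Aid Acomp.
by refine (ex_intro _ (@LaxFunctor C D A Acell Aid Acomp _ _ _ _ _ _) erefl);
  move=> *; exact: thin.
Qed.

Lemma Corr_Gr_thin (G F : Corr_Gr) (S T : Defs.hom G F) (a b : cell S T) : a = b.
Proof. exact: (@Prop_irrelevance (corr_set S `<=` corr_set T)). Qed.

Lemma corr_diag_sub_map_corr (R : realType) (X : topologicalType) :
  corr_diag (selfE R X) `<=` map_corr R (cid_map X).
Proof.
move=> [a _] /= <-; exists (repr a), (repr a); split.
  by rewrite hclass_repr.
by apply: homotopic_of_eq; rewrite ccomp_idl ccomp_idr.
Qed.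

(** A member of the composite is given by squares [f hX ~ hY f] and
    [g kY ~ kZ g] where [hY] and [kY] only represent the same class, so a
    homotopy [hY ~ kY] has to be inserted between them:
    [g f hX ~ g hY f ~ g kY f ~ kZ g f]. *)
Lemma map_corr_comp_sub (R : realType) (X Y Z : topologicalType)
    (f : continuousType X Y) (g : continuousType Y Z) :
  corr_comp (map_corr R g) (map_corr R f) `<=` map_corr R (ccomp g f).
Proof.
move=> [a c] [b [[hX [hY [[-> bhY] hf]]] [kY [kZ [[bkY ->] kg]]]]].
exists hX, kZ; split=> //.
have hk : homotopic R (\val hY) (\val kY) by apply/hclass_eqP; rewrite -bhY.
have f_hX : homotopic R (ccomp f (\val hX)) (ccomp (\val kY) f).
  apply: homotopic_trans hf _.
  by apply: homotopic_comp hk _; exact: homotopic_refl.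
rewrite -ccompA.
apply: (@homotopic_trans _ _ _ _ (ccomp g (ccomp (\val kY) f))).
  by apply: homotopic_comp; first exact: homotopic_refl.
rewrite !ccompA.
by apply: homotopic_comp kg _; exact: homotopic_refl.
Qed.

Theorem theorem4p8 (R : realType) :
  (exists F : lax_functor Top Corr_Gr, lax_assignment F = selfE_assignment R) /\
  (forall (X Y Z : topologicalType)
      (f : continuousType X Y) (g : continuousType Y Z),
    corr_set (corr_comp (map_corr R g) (map_corr R f)) `<=`
    corr_set (map_corr R (ccomp g f))).
Proof.
split; last exact: map_corr_comp_sub.
apply: lax_functor_of_thin.
- exact: Corr_Gr_thin.
- by move=> X Y f g; case: _ /.
- exact: corr_diag_sub_map_corr.
- exact: map_corr_comp_sub.
Qed.
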